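(* For each $\varepsilon>0$ there exist $c=c(\varepsilon)$ and $\eta=\eta(\varepsilon)\in(0,1]$ such that the following holds. Let the graph $G$ and the probability $p\in(0,1]$ satisfy $e(G)\,p/v(G)\ge c$. Then, with probability at least $1-\varepsilon$, the following statements (a) and (b) both hold: (a) the random graph $G_p$ satisfies $|q^*(G_p)-q^*(G)|<\varepsilon$; and (b) for every partition $\mathcal{A}$ of the vertex set, in a linear number of operations (seeing only $G_p$) the greedy amalgamating algorithm, run on $G_p$ with parameter $\eta$ and input partition $\mathcal{A}$, finds a partition $\mathcal{A}'$ with $q_{\mathcal{A}'}(G)\ge q_{\mathcal{A}}(G_p)-\varepsilon$.
   Context: Graphs are finite and simple; $v(G)$, $e(G)$ are the numbers of vertices and edges of $G$. For a graph $G$ with $m\ge 1$ edges and a vertex partition $\mathcal{A}$, the modularity score is $q_{\mathcal{A}}(G)=\frac1m\sum_{A\in\mathcal{A}}e(A)-\frac1{4m^2}\sum_{A\in\mathcal{A}}\mathrm{vol}_G(A)^2$, where $e(A)$ is the number of edges of $G$ inside $A$ and $\mathrm{vol}_G(A)$ is the sum of the degrees in $G$ of the vertices in $A$; write $\mathrm{vol}(G)=2e(G)$. If $G$ has no edges, $q_{\mathcal{A}}(G)=0$. The modularity is $q^*(G)=\max_{\mathcal{A}}q_{\mathcal{A}}(G)$ over all vertex partitions. $G_p$ is the random subgraph of $G$ on the same vertex set obtained by keeping each edge independently with probability $p$. Greedy bi-partitioning: given $y_1\ge\dots\ge y_r>0$ with $\sum_i y_i=1$, start with $A=B=\emptyset$;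 for $j=1,\dots,r$ insert $j$ into $A$ if $\sum_{i\in A}y_i\le\sum_{i\in B}y_i$, and otherwise into $B$. Let $\gamma(y)$ be the minimum of the two final sums $\sum_{i\in A}y_i$, $\sum_{i\in B}y_i$. Greedy amalgamating algorithm: the input is a graph $H$ with at least one edge, $\eta\in(0,1]$ and a partition $\mathcal{B}=(B_1,\dots,B_n)$ of $V(H)$. Let $x_i=\mathrm{vol}_H(B_i)/\mathrm{vol}(H)$, with parts ordered so that $x_1\ge\dots\ge x_n$ (parts of volume 0 consist of isolated vertices, which are irrelevant to modularity scores in $H$; take them to be merged into an arbitrary other part, so that all $x_i>0$). Start with the trivial partition of $[n]$ into one part. While there is a part $I$ of the current partition of $[n]$ such that, with $S=\sum_{i\in I}x_i$ and $y=(x_i/S:i\in I)$, we have $\gamma(y)\ge\eta/S$, take the first such part $I$ and split it into the two sets produced by greedy bi-partitioning of $y$. If the final partition of $[n]$ is $(I_1,\dots,I_k)$, output the partition of $V(H)$ with parts $\bigcup_{i\in I_j}B_i$, $j=1,\dots,k$. (If $H$ has no edges, output the trivial partition.) ''Operations'' are arithmetic operations and comparisons of numbers; ''linear'' means linear in the number $n$ of parts of the input partition, for fixed $\eta$, given the ordered list of values $x_i$. *)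

(* Defs.v *)
From HB Require Import structures.
From mathcomp Require Import all_boot all_order all_algebra.
From mathcomp Require Import boolp reals.

Set Implicit Arguments.
Unset Strict Implicit.
Unset Printing Implicit Defensive.

Import Order.TTheory GRing.Theory Num.Theory.
Local Open Scope ring_scope.

Record sgraph (T : finType) := SGraph {
  edges : {set {set T}};
  edges_card2 : [forall e in edges, #|e| == 2%N]
}.

HB.instance Definition _ (T : finType) := [isSub for @edges T].
HB.instance Definition _ (T : finType) := [Finite of sgraph T by <:].

Section Graph.
Variables (T : finType) (G : sgraph T).

Definition num_vertices : nat := #|T|.
Definition num_edges : nat := #|edges G|.
Definition deg (v : T) : nat := #|[set e in edges G | v \in e]|.
Definition edges_in (A : {set T}) : nat := #|[set e in edges G | e \subset A]|.
Definition vol (A : {set T}) : nat := \sum_(v in A) deg v.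
Definition total_vol : nat := 2 * num_edges.

End Graph.

Section Modularity.
Variables (R : realType) (T : finType) (G : sgraph T).

Definition modularity_score (P : {set {set T}}) : R :=
  if num_edges G == 0%N then 0 else
  let m : R := (num_edges G)%:R in
  m^-1 * (\sum_(A in P) (edges_in G A)%:R)
  - (4 * m ^+ 2)^-1 * (\sum_(A in P) (vol G A)%:R ^+ 2).

(* The maximum starts from the score of the one-part partition, so that no
   foreign default value enters. *)
Definition modularity : R :=
  \big[Num.max/modularity_score [set [set: T]]]_(P : {set {set T}}
     | partition P [set: T]) modularity_score P.

End Modularity.

Section RandomSubgraph.
Variables (R : realType) (T : finType) (G : sgraph T) (p : R).

Definition random_subgraph_pmf (H : sgraph T) : R :=
  if edges H \subset edges G
  then \prod_(e in edges G) (if e \in edges H then p else 1 - p)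
  else 0.

Definition random_subgraph_prob (Q : sgraph T -> Prop) : R :=
  \sum_(H : sgraph T | `[< Q H >]) random_subgraph_pmf H.

End RandomSubgraph.

(* The result of a computation, paired with the number of arithmetic operations
   and comparisons of numbers that it performed.  [op] performs one of these;
   the handling of indices and of sets of indices is free. *)
Definition costed (X : Type) : Type := (X * nat)%type.
Definition ret {X : Type} (a : X) : costed X := (a, 0%N).
Definition op {X : Type} (a : X) : costed X := (a, 1%N).
Definition bind {X Y : Type} (m : costed X) (k : X -> costed Y) : costed Y :=
  ((k m.1).1, (m.2 + (k m.1).2)%N).

Notation "'let!' x ':=' m 'in' k" := (bind m (fun x => k))
  (at level 200, x name, m at level 100, k at level 200).

Section GreedyLoop.
Variables (R : realType) (n : nat) (x : 'I_n -> R) (eta : R).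

Fixpoint sum_op (s : seq 'I_n) (acc : R) : costed R :=
  if s is i :: s' then
    let! acc' := op (acc + x i) in sum_op s' acc'
  else ret acc.

Fixpoint normalize_op (S : R) (s : seq 'I_n) : costed (seq ('I_n * R)) :=
  if s is i :: s' then
    let! yi := op (x i / S) in
    let! ys := normalize_op S s' in
    ret ((i, yi) :: ys)
  else ret [::].

(* Greedy bi-partitioning of the remaining values [ys], when [A] and [B] are
   the current sets and [a] and [b] their current sums. *)
Fixpoint bipartition_op (ys : seq ('I_n * R)) (A B : {set 'I_n}) (a b : R) :
    costed (({set 'I_n} * {set 'I_n}) * (R * R)) :=
  if ys is (j, y) :: ys' then
    let! a_le_b := op (a <= b) in
    if a_le_b then
      let! a' := op (a + y) in bipartition_op ys' (j |: A) B a' b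
    else
      let! b' := op (b + y) in bipartition_op ys' A (j |: B) a b'
  else ret ((A, B), (a, b)).

(* Since [enum I] lists the indices in increasing order, the values are
   processed in nonincreasing order as soon as [x] is nonincreasing.  The number
   compared with [eta / S] is gamma(y), for y = (x_i / S : i in I). *)
Definition split_part (I : {set 'I_n}) :
    costed (option ({set 'I_n} * {set 'I_n})) :=
  let! S := sum_op (enum I) 0 in
  let! ys := normalize_op S (enum I) in
  let! r := bipartition_op ys set0 set0 0 0 in
  let! gamma := op (Num.min r.2.1 r.2.2) in
  let! threshold := op (eta / S) in
  let! splits := op (threshold <= gamma) in
  ret (if splits then Some r.1 else None).

Fixpoint split_first (P : seq {set 'I_n}) :
    costed (option (seq {set 'I_n})) :=
  if P is J :: P' then
    let! r := split_part J in
    if r is Some AB then ret (Some [:: AB.1, AB.2 & P'])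
    else let! r' := split_first P' in ret (omap (cons J) r')
  else ret None.

(* [greedy_loop P Q N]: started from the list of parts [P], the while loop
   terminates with the list of parts [Q], after [N] operations.  A split replaces
   a part in place; since whether a part gets split depends on that part alone,
   the final partition does not depend on the order of the list. *)
Inductive greedy_loop :
    seq {set 'I_n} -> seq {set 'I_n} -> nat -> Prop :=
| GreedyStop P N :
    split_first P = (None, N) -> greedy_loop P P N
| GreedyStep P P' Q M N :
    split_first P = (Some P', M) -> greedy_loop P' Q N ->
    greedy_loop P Q (M + N)%N.

End GreedyLoop.

Section GreedyAmalgamating.
Variables (R : realType) (T : finType) (H : sgraph T).

(* [greedy_input A B]: [B] is a way to present the partition [A] to the
   algorithm.  If [H] has an edge, [s] orders the parts of positive volume (ties
   being broken arbitrarily), and each part [Z] of volume 0 is merged into an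
   arbitrary part [f Z] of positive volume. *)
Variant greedy_input (A : {set {set T}}) : seq {set T} -> Prop :=
| EdgelessInput B :
    num_edges H = 0%N -> perm_eq B (enum A) -> greedy_input A B
| MergedInput (s : seq {set T}) (f : {set T} -> {set T}) :
    (0 < num_edges H)%N ->
    perm_eq s (enum [set X in A | (0 < vol H X)%N]) ->
    sorted (fun X Y => (vol H Y <= vol H X)%N) s ->
    (forall Z, Z \in A -> vol H Z = 0%N -> f Z \in s) ->
    greedy_input A
      [seq X :|: \bigcup_(Z in A | (vol H Z == 0%N) && (f Z == X)) Z | X <- s].

(* [greedy_amalgamating eta B A' N]: with parameter [eta], the algorithm run on
   [H] and [B] terminates with output [A'] after [N] operations, the values
   x_i = vol(B_i) / vol(H) being given. *)
Variant greedy_amalgamating (eta : R) (B : seq {set T}) :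
    {set {set T}} -> nat -> Prop :=
| GreedyEdgeless :
    num_edges H = 0%N -> greedy_amalgamating eta B [set [set: T]] 0
| GreedyAmalgamated (P : seq {set 'I_(size B)}) (N : nat) :
    (0 < num_edges H)%N ->
    greedy_loop
      (fun i : 'I_(size B) => (vol H (nth set0 B i))%:R / (total_vol H)%:R)
      eta [:: [set: 'I_(size B)]] P N ->
    greedy_amalgamating eta B
      [set \bigcup_(i in J) nth set0 B i | J : {set 'I_(size B)} in P] N.

End GreedyAmalgamating.

(* Main.v *)
Require Import Defs.
From HB Require Import structures.
From mathcomp Require Import all_boot all_order all_algebra.
From mathcomp Require Import boolp reals sequences exp.
From mathcomp Require Import zify ring lra.

(** Why the theorem holds.  Write [m] for the number of edges of [G], [n] for its
    number of vertices and [k = 1 / eta], a constant depending on [eps] only.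

    Partitions into many parts are no better than partitions into at most [k] parts, up
    to [O(eta)].  Indeed the greedy bi-partitioning of weights [y] of sum 1 keeps the
    difference of its two sums at most [max y], so that [gamma y >= (1 - max y) / 2].
    A set of blocks that the algorithm leaves unsplit is therefore made of one dominant block
    and blocks of total relative volume less than [2 * eta] ([split_partP]).
    Merging such a set loses no edge and increases the degree tax by little
    ([modularity_score_coarsen]).  On the other hand both halves of a split have relative
    volume at least [eta], so there are never more than [k] parts; this bounds the
    number of passes, each of linear cost, and hence the running time
    ([greedy_loop_exists], [greedy_amalgamatingP]).

    On partitions into at most [k] parts the scores in [G] and in [G_p] are uniformly
    close.  The score of such a partition is a function of the numbers [e(S)] of
    edges inside [2 * k + 1] vertex sets: the parts, their complements, which give the volumes
    ([vol_edges_in]), and the whole vertex set.  So it suffices that in [G_p] every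
    [e(S)] be within [d * p * m] of [p] times its value in [G]
    ([modularity_score_close]).  By Chernoff's bound a given [S] violates this with
    probability exponentially small in [p * m], hence in [c * n]; for [c] large this
    beats the [2 ^ n] choices of [S] ([edge_counts_close_prob]).

    On that event (b) follows by running the algorithm on [G_p] and transferring the score
    of its output to [G].  For (a), an optimal partition of either graph is first
    amalgamated and then transferred to the other graph ([modularity_transfer]). *)

Set Implicit Arguments.
Unset Strict Implicit.
Unset Printing Implicit Defensive.

Import Order.TTheory GRing.Theory Num.Theory.
Local Open Scope ring_scope.

(** * Edges inside a vertex set, and volumes *)

Section EdgeCounts.
Variables (T : finType) (G : sgraph T).

Lemma edge_card2 (e : {set T}) : e \in edges G -> #|e| = 2%N.
Proof. by move=> eG; apply/eqP/(forall_inP (edges_card2 G)). Qed.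

Lemma edges_inE (S : {set T}) :
  edges_in G S = (\sum_(e in edges G) (e \subset S))%N.
Proof.
rewrite /edges_in -sum1_card big_mkcond [RHS]big_mkcond.
by apply: eq_bigr => e _; rewrite inE; case: (e \in edges G); case: (e \subset S).
Qed.

Lemma edges_inT : edges_in G setT = num_edges G.
Proof.
rewrite /edges_in; congr #|pred_of_set _|.
by apply/setP => e; rewrite inE subsetT andbT.
Qed.

Lemma edges_in_le (S : {set T}) : (edges_in G S <= num_edges G)%N.
Proof. by apply/subset_leq_card/subsetP => e; rewrite inE => /andP[]. Qed.

Lemma volE (S : {set T}) : vol G S = (\sum_(e in edges G) #|S :&: e|)%N.
Proof.
rewrite /vol.
transitivity (\sum_(v in S) \sum_(e in edges G) (v \in e))%N.
  apply: eq_bigr => v _; rewrite /deg -sum1_card big_mkcond [RHS]big_mkcond.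
  by apply: eq_bigr => e _; rewrite inE; case: (e \in edges G); case: (v \in e).
rewrite exchange_big; apply: eq_bigr => e _ /=.
rewrite -sum1_card big_mkcond [RHS]big_mkcond.
by apply: eq_bigr => v _; rewrite inE; case: (v \in S); case: (v \in e).
Qed.

(** An edge adds 2, 1 or 0 to the volume of [S] when it lies inside [S], on the
    boundary, or outside.  Volumes are thereby controlled as soon as the numbers
    of edges inside all vertex sets are. *)
Lemma vol_edges_in (S : {set T}) :
  (vol G S + edges_in G (~: S) = edges_in G S + num_edges G)%N.
Proof.
rewrite volE !edges_inE /num_edges -sum1_card -!big_split /=.
apply: eq_bigr => e /edge_card2/eqP/cards2P[x [y [xy ->]]].
rewrite !subUset !sub1set !inE setIUr !(setIC S).
have setI1 z : [set z] :&: S = if z \in S then [set z] else set0.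
  by apply/setP => w; case: ifP => zS; rewrite !inE; case: eqP => // ->; rewrite zS.
rewrite !setI1; case: (x \in S); case: (y \in S);
  by rewrite ?set0U ?setU0 ?cards0 ?cards1 ?cards2 ?xy.
Qed.

Lemma volT : vol G setT = total_vol G.
Proof.
have := vol_edges_in setT; rewrite setCT edges_inT /total_vol.
suff -> : edges_in G set0 = 0%N by lia.
apply/eqP; rewrite cards_eq0; apply/eqP/setP => e; rewrite !inE subset0.
by apply/negbTE/negP => /andP[/edge_card2 + /eqP e0]; rewrite e0 cards0.
Qed.

Lemma vol_subset (S S' : {set T}) : S \subset S' -> (vol G S <= vol G S')%N.
Proof.
move=> SS'; rewrite !volE; apply: leq_sum => e _.
by apply/subset_leq_card/setSI.
Qed.

Lemma vol_le (S : {set T}) : (vol G S <= 2 * num_edges G)%N.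
Proof. by rewrite -[leqRHS]volT vol_subset ?subsetT. Qed.

Lemma vol_partition (P : {set {set T}}) (D : {set T}) :
  partition P D -> (\sum_(A in P) vol G A = vol G D)%N.
Proof. by move=> PD; rewrite /vol (set_partition_big _ PD). Qed.

(** Parts are disjoint and edges are nonempty, so an edge is inside at most one part. *)
Lemma edges_in_partition (P : {set {set T}}) (D : {set T}) : partition P D ->
  (\sum_(A in P) edges_in G A =
   #|[set e in edges G | [exists A in P, e \subset A]]|)%N.
Proof.
move=> PD.
under eq_bigr do rewrite edges_inE.
rewrite exchange_big -sum1_card big_mkcond [RHS]big_mkcond /=.
apply: eq_bigr => e _; rewrite inE; case: ifP => //= eG.
case: ifP => [/existsP[A /andP[AP eA]]|/existsPn noA]; last first.
  by rewrite big1 // => A AP; have := noA A; rewrite AP /= => /negbTE ->.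
rewrite (bigD1 A) //= eA big1 // => A' /andP[A'P A'A].
apply/eqP; rewrite eqb0; apply/negP => eA'.
have /card_gt0P[v ve] : (0 < #|e|)%N by rewrite (edge_card2 eG).
have tP := partition_trivIset PD.
case/eqP: A'A.
by rewrite -(def_pblock tP A'P (subsetP eA' _ ve)) -(def_pblock tP AP (subsetP eA _ ve)).
Qed.

End EdgeCounts.

(** * Comparing modularity scores *)

Section Scores.
Variable R : realType.

Lemma modularity_scoreE (T : finType) (G : sgraph T) (P : {set {set T}}) :
  (0 < num_edges G)%N ->
  modularity_score R G P =
    \sum_(A in P) ((edges_in G A)%:R / (num_edges G)%:R
                   - ((vol G A)%:R / (total_vol G)%:R) ^+ 2).
Proof.
move=> m_gt0; rewrite /modularity_score (gtn_eqF m_gt0).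
rewrite sumrB !mulr_sumr; congr (_ - _); apply: eq_bigr => A _; first exact: mulrC.
rewrite /total_vol natrM expr_div_n exprMn mulrC.
by congr (_ / (_ * _)); ring.
Qed.

Lemma le_modularity (T : finType) (G : sgraph T) (P : {set {set T}}) :
  partition P setT -> modularity_score R G P <= modularity R G.
Proof.
exact: (@le_bigmax_cond _ _ _ _ P (fun P => partition P setT) (modularity_score R G)).
Qed.

Lemma modularity_le (T : finType) (G : sgraph T) (b : R) : (0 < #|T|)%N ->
  (forall P, partition P [set: T] -> modularity_score R G P <= b) ->
  modularity R G <= b.
Proof.
move=> T_gt0 scoreb; apply: bigmax_le; last exact: scoreb.
apply: scoreb; rewrite /partition cover1 trivIset1 eqxx inE /=.
by rewrite eq_sym -cards_eq0 cardsT -lt0n.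
Qed.

(** Merging parts does not lose edges, so only the degree tax can increase.  When
    each merged part is one old part [A] plus little volume, [vol C ^ 2] exceeds
    [vol A ^ 2] by at most [2 * vol C] times that little, and the volumes of the
    parts sum to [2m]. *)
Lemma modularity_score_coarsen (T : finType) (G : sgraph T)
    (P Q : {set {set T}}) (b : R) :
  (0 < num_edges G)%N -> 0 <= b ->
  partition P [set: T] -> partition Q [set: T] ->
  (forall A, A \in P -> exists2 C, C \in Q & A \subset C) ->
  (forall C, C \in Q -> exists A, [/\ A \in P, A \subset C &
     (vol G C)%:R <= (vol G A)%:R + b * (total_vol G)%:R]) ->
  modularity_score R G P - 2 * b <= modularity_score R G Q.
Proof.
move=> m_gt0 b_ge0 PT QT refine dominant.
set V : R := (total_vol G)%:R.
have V_gt0 : 0 < V by rewrite ltr0n /total_vol muln_gt0.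
rewrite !modularity_scoreE // !sumrB.
have edges_le : \sum_(A in P) ((edges_in G A)%:R / (num_edges G)%:R : R) <=
                \sum_(C in Q) (edges_in G C)%:R / (num_edges G)%:R.
  rewrite -!mulr_suml ler_pM2r ?invr_gt0 ?ltr0n // -!natr_sum ler_nat.
  rewrite (edges_in_partition G PT) (edges_in_partition G QT).
  apply/subset_leq_card/subsetP => e; rewrite !inE => /andP[-> /=].
  case/existsP=> A /andP[/refine[C CQ AC] eA]; apply/existsP; exists C.
  by rewrite CQ (subset_trans eA AC).
suff tax_le : \sum_(C in Q) ((vol G C)%:R / V) ^+ 2 <=
              \sum_(A in P) ((vol G A)%:R / V) ^+ 2 + 2 * b by lra.
(* dom C is the dominant old part of C; it lies in C, so distinct C have distinct
   dominant parts. *)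
pose dom (C : {set T}) := odflt set0 [pick A | [&& A \in P, A \subset C &
     (vol G C)%:R <= (vol G A)%:R + b * V]].
have domP C : C \in Q -> [/\ dom C \in P, dom C \subset C &
     (vol G C)%:R <= (vol G (dom C))%:R + b * V].
  rewrite /dom => /dominant[A [AP AC volA]]; case: pickP => [B /and3P[] //|/(_ A)].
  by rewrite AP AC volA.
have dom_inj : {in Q &, injective dom}.
  move=> C D CQ DQ eqCD; have [dP dC _] := domP C CQ; have [_ dD _] := domP D DQ.
  have [v vd] : exists v, v \in dom C.
    apply/set0Pn; apply: contraTneq dP => ->; by case/and3P: PT.
  have tQ := partition_trivIset QT.
  rewrite -(def_pblock tQ CQ (subsetP dC _ vd)).
  by apply: (def_pblock tQ DQ); rewrite (subsetP dD) // -eqCD.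
have dom_le : \sum_(C in Q) ((vol G (dom C))%:R / V) ^+ 2 <=
              \sum_(A in P) ((vol G A)%:R / V) ^+ 2.
  rewrite -(big_imset (fun A => ((vol G A)%:R / V) ^+ 2) dom_inj) /=.
  rewrite [leRHS](bigID (mem [set dom C | C in Q])) /=.
  rewrite [X in _ <= X + _](eq_bigl (mem [set dom C | C in Q])).
    by rewrite lerDl sumr_ge0 // => A _; exact: sqr_ge0.
  move=> A; apply: andb_idl => /imsetP[C CQ ->]; by case: (domP C CQ).
apply: le_trans (_ : \sum_(C in Q) (((vol G (dom C))%:R / V) ^+ 2
                       + 2 * b * ((vol G C)%:R / V)) <= _).
  apply: ler_sum => C CQ; have [_ dC volC] := domP C CQ.
  have x_ge0 : 0 <= (vol G (dom C))%:R / V :> R by rewrite divr_ge0 ?ler0n.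
  have xy : (vol G (dom C))%:R / V <= (vol G C)%:R / V :> R.
    by rewrite ler_pM2r ?invr_gt0 // ler_nat vol_subset.
  have yx : (vol G C)%:R / V <= (vol G (dom C))%:R / V + b.
    by rewrite ler_pdivrMr // mulrDl divfK ?gt_eqF.
  by nra.
rewrite big_split /= -mulr_sumr -mulr_suml -natr_sum (vol_partition G QT) volT.
by rewrite divff ?gt_eqF // mulr1 lerD2r.
Qed.

Lemma ratio_close (a' a m' m r d : R) : 0 < m -> 0 < m' -> 0 <= a' <= m' ->
  `|a' - a| <= r * m -> `|m' - m| <= d * m -> `|a' / m' - a / m| <= r + d.
Proof.
move=> m_gt0 m'_gt0 /andP[a'_ge0 a'_le] a'a m'm.
have -> : a' / m' - a / m = (a' - a) / m - a' / m' * ((m' - m) / m).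
  by field; rewrite !gt_eqF.
apply: le_trans (ler_normB _ _) _; apply: lerD.
  by rewrite normrM normfV (gtr0_norm m_gt0) ler_pdivrMr.
rewrite normrM -[d]mul1r ler_pM //.
  have m'_ge0 := ltW m'_gt0.
  by rewrite ger0_norm ?divr_ge0 // ler_pdivrMr // mul1r.
by rewrite normrM normfV (gtr0_norm m_gt0) ler_pdivrMr.
Qed.

(** The event on which both conclusions of the theorem hold, for a random subgraph [H]. *)
Definition edge_counts_close (T : finType) (G H : sgraph T) (p d : R) : Prop :=
  forall S : {set T},
    `|(edges_in H S)%:R - p * (edges_in G S)%:R| <= d * (p * (num_edges G)%:R).

Lemma edge_counts_close_gt0 (T : finType) (G H : sgraph T) (p d : R) :
  (0 < num_edges G)%N -> 0 < p -> d < 1 -> edge_counts_close G H p d ->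
  (0 < num_edges H)%N.
Proof.
move=> m_gt0 p_gt0 d_lt1 /(_ setT); rewrite !edges_inT ler_norml => /andP[+ _].
rewrite -(ltr0n R).
have : 0 < p * (num_edges G)%:R by rewrite mulr_gt0 ?ltr0n.
by nra.
Qed.

(** The two ratios making up the contribution of one part to the score are
    each stable: the edge ratio moves by at most [2d] and the volume
    ratio by at most [5d / 2], which at most doubles upon squaring. *)
Lemma modularity_score_close (T : finType) (G H : sgraph T) (p d : R)
    (P : {set {set T}}) :
  (0 < num_edges G)%N -> 0 < p -> 0 < d < 1 -> edge_counts_close G H p d ->
  `|modularity_score R H P - modularity_score R G P| <= #|P|%:R * (7 * d).
Proof.
move=> mG_gt0 p_gt0 /andP[d_gt0 d_lt1] close.
have mH_gt0 := edge_counts_close_gt0 mG_gt0 p_gt0 d_lt1 close.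
rewrite !modularity_scoreE // -sumrB.
have -> : #|P|%:R * (7 * d) = \sum_(A in P) 7 * d by rewrite sumr_const mulr_natl.
apply: le_trans (ler_norm_sum _ _ _) _. apply: ler_sum => A _.
set M := p * (num_edges G)%:R.
have M_gt0 : 0 < M by rewrite mulr_gt0 ?ltr0n.
have cA := close A; have cAC := close (~: A); have := close setT.
rewrite !edges_inT -/M => cT; rewrite -/M in cA cAC.
have scale (x y : R) : x / y = (p * x) / (p * y).
  by rewrite -mulf_div divff ?mul1r ?gt_eqF.
have edge_close : `|(edges_in H A)%:R / (num_edges H)%:R
                    - (edges_in G A)%:R / (num_edges G)%:R| <= d + d.
  rewrite [(edges_in G A)%:R / _]scale.
  by apply: ratio_close; rewrite ?ltr0n ?ler0n ?ler_nat ?edges_in_le.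
have volR (K : sgraph T) : (vol K A)%:R =
    (edges_in K A)%:R + (num_edges K)%:R - (edges_in K (~: A))%:R :> R.
  by apply/eqP; rewrite eq_sym subr_eq -!natrD vol_edges_in.
have vol_close : `|(vol H A)%:R / (total_vol H)%:R
                    - (vol G A)%:R / (total_vol G)%:R| <= 3 / 2 * d + d.
  rewrite [(vol G A)%:R / _]scale.
  have -> : p * (total_vol G)%:R = 2 * M by rewrite /M natrM; ring.
  apply: ratio_close; rewrite ?mulr_gt0 ?ltr0n ?muln_gt0 ?ler0n ?ler_nat ?vol_le //.
    rewrite !volR; move: cA cAC cT; rewrite /M !ler_norml.
    move=> /andP[? ?] /andP[? ?] /andP[? ?]; apply/andP; split; lra.
  rewrite /total_vol natrM -mulrBr normrM ger0_norm //; lra.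
have ratio01 (K : sgraph T) : (0 < num_edges K)%N ->
    0 <= ((vol K A)%:R / (total_vol K)%:R : R) <= 1.
  move=> mK_gt0; rewrite divr_ge0 //= ler_pdivrMr ?ltr0n ?muln_gt0 //.
  by rewrite mul1r ler_nat vol_le.
move: (ratio01 G mG_gt0) (ratio01 H mH_gt0) edge_close vol_close.
set eH := (edges_in H A)%:R / _; set eG := (edges_in G A)%:R / _.
set vH := (vol H A)%:R / _; set vG := (vol G A)%:R / _.
move=> /andP[vG0 vG1] /andP[vH0 vH1] edge_close vol_close.
have sqr_close : `|vH ^+ 2 - vG ^+ 2| <= (3 / 2 * d + d) * 2.
  rewrite subr_sqr normrM ler_pM //.
  by rewrite ger0_norm ?addr_ge0 //; lra.
move: edge_close sqr_close; rewrite !ler_norml.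
by move=> /andP[? ?] /andP[? ?]; apply/andP; split; lra.
Qed.

End Scores.

(** * The greedy loop *)

Section GreedyLoopAnalysis.
Variables (R : realType) (n : nat).

Lemma sum_opE (x : 'I_n -> R) (s : seq 'I_n) (a : R) :
  sum_op x s a = (a + \sum_(i <- s) x i, size s).
Proof.
elim: s a => [|i s IHs] a /=; first by rewrite big_nil addr0.
by rewrite /bind /= IHs big_cons addrA.
Qed.

Lemma normalize_opE (x : 'I_n -> R) (S : R) (s : seq 'I_n) :
  normalize_op x S s = ([seq (i, x i / S) | i <- s], size s).
Proof. by elim: s => //= i s IHs; rewrite /bind /= IHs addn0. Qed.

(** Adding a value at most [M] to the smaller of two sums that differ by at most
    [M] keeps the difference at most [M], whatever the order of the values. *)
Lemma bipartition_opP (z : 'I_n -> R) (M : R) (s : seq 'I_n) (A B : {set 'I_n}) :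
  uniq s -> (forall i, i \in s -> (i \notin A) && (i \notin B)) ->
  (forall i, i \in s -> 0 <= z i <= M) ->
  `|\sum_(i in A) z i - \sum_(i in B) z i| <= M ->
  exists A' B' : {set 'I_n},
    [/\ bipartition_op [seq (i, z i) | i <- s] A B
          (\sum_(i in A) z i) (\sum_(i in B) z i) =
          (((A', B'), (\sum_(i in A') z i, \sum_(i in B') z i)), (2 * size s)%N),
        (forall i, ((i \in A') + (i \in B') =
                    (i \in A) + (i \in B) + (i \in s))%N) &
        `|\sum_(i in A') z i - \sum_(i in B') z i| <= M].
Proof.
elim: s A B => [|j s IHs] A B /=.
  by move=> _ _ _ AB; exists A, B; split=> // i; rewrite addn0.
case/andP=> js us disj zM AB.
have /andP[jA jB] := disj j (mem_head _ _).
have /andP[zj0 zjM] := zM j (mem_head _ _).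
have zM' i : i \in s -> 0 <= z i <= M by move=> si; apply: zM; rewrite inE si orbT.
have disj' i : i \in s -> [/\ i != j, i \notin A & i \notin B].
  move=> si; have /andP[iA iB] : (i \notin A) && (i \notin B).
    by apply: disj; rewrite inE si orbT.
  by split=> //; apply: contraNneq js => <-.
rewrite /bind /=; case: ifP => ab.
  have sumA : \sum_(i in A) z i + z j = \sum_(i in j |: A) z i.
    by rewrite big_setU1 //= addrC.
  rewrite sumA; have [||A' [B' [-> cnt AB']]] := IHs (j |: A) B us _ zM'.
  - by move=> i /disj'[ij iA iB]; rewrite !inE negb_or ij iA.
  - by rewrite -sumA; move: AB; rewrite !ler_norml => /andP[? ?]; apply/andP; split; lra.
  exists A', B'; split=> //=; first by congr pair; lia.
  move=> i; rewrite cnt !inE; case: eqVneq => [->|_] /=; last by [].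
  by rewrite (negbTE jA) (negbTE js) (negbTE jB).
have sumB : \sum_(i in B) z i + z j = \sum_(i in j |: B) z i.
  by rewrite big_setU1 //= addrC.
have {}ab : \sum_(i in B) z i < \sum_(i in A) z i by rewrite ltNge ab.
rewrite sumB; have [||A' [B' [-> cnt AB']]] := IHs A (j |: B) us _ zM'.
- by move=> i /disj'[ij iA iB]; rewrite !inE negb_or ij iA.
- by rewrite -sumB; move: AB; rewrite !ler_norml => /andP[? ?]; apply/andP; split; lra.
exists A', B'; split=> //=; first by congr pair; lia.
move=> i; rewrite cnt !inE; case: eqVneq => [->|_] /=; last by [].
by rewrite (negbTE jA) (negbTE js) (negbTE jB).
Qed.

Variables (x : 'I_n -> R) (eta : R).
Hypotheses (x_gt0 : forall i, 0 < x i) (x_sum : \sum_i x i = 1).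
Hypothesis (eta_gt0 : 0 < eta).

Definition weight (J : {set 'I_n}) : R := \sum_(i in J) x i.

(** One index carries all of the weight of [J], up to [2 * eta]. *)
Definition dominated (J : {set 'I_n}) : Prop :=
  exists2 i, i \in J & weight J <= x i + 2 * eta.

(** With [y] the normalized weights, the two sums [a + b = 1] satisfy
    [|a - b| <= max y], so that [gamma y = (1 - |a - b|) / 2 >= (1 - max y) / 2].
    Hence a part that is not split is dominated by its largest index. *)
Lemma split_partP (J : {set 'I_n}) : (0 < #|J|)%N ->
  (split_part x eta J).2 = (4 * #|J| + 3)%N /\
  match (split_part x eta J).1 with
  | None => dominated J
  | Some AB => [/\ forall i, ((i \in AB.1) + (i \in AB.2) = (i \in J))%N,
                   eta <= weight AB.1 & eta <= weight AB.2]
  end.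
Proof.
case/card_gt0P=> j0 Jj0.
pose j := [arg max_(i > j0 in J) x i]%O.
have [Jj jmax] : j \in J /\ (forall i, i \in J -> x i <= x j).
  by rewrite /j; case: arg_maxP.
set S := weight J.
have S_gt0 : 0 < S.
  apply: lt_le_trans (x_gt0 j) _; rewrite /S /weight (bigD1 j) //= lerDl.
  by apply: sumr_ge0 => i _; exact: ltW.
have sumS (A : {set 'I_n}) : \sum_(i in A) x i / S = weight A / S by rewrite -mulr_suml.
have xj_ge0 : 0 <= x j / S by rewrite divr_ge0 // ltW.
have [||||A [B [bip cnt AB]]] :=
    @bipartition_opP (fun i => x i / S) (x j / S) (enum J) set0 set0.
- exact: enum_uniq.
- by move=> i _; rewrite !inE.
- move=> i; rewrite mem_enum => iJ.
  by rewrite divr_ge0 ?(ltW (x_gt0 _)) ?(ltW S_gt0) //= ler_pM2r ?invr_gt0 ?jmax.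
- by rewrite !big_set0 subr0 normr0.
rewrite !big_set0 in bip.
have cntAB i : ((i \in A) + (i \in B) = (i \in J))%N by rewrite cnt !inE mem_enum.
have AB1 : weight A + weight B = S.
  rewrite /weight big_mkcond [X in _ + X]big_mkcond -big_split [RHS]big_mkcond.
  apply: eq_bigr => i _ /=; move: (cntAB i).
  by case: (i \in A); case: (i \in B); case: (i \in J); rewrite ?addr0 ?add0r.
rewrite /split_part sum_opE big_enum add0r -/(weight J) -/S /bind /= normalize_opE.
rewrite bip /= -cardE; split; first by move: #|J| => k; lia.
rewrite !sumS in AB *.
case: ifP => [|/negbT]; rewrite le_min !ler_pM2r ?invr_gt0 //.
  by move=> /andP[? ?]; split.
rewrite negb_and -!ltNge => lt_eta; exists j => //.
have : `|weight A - weight B| <= x j.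
  by move: AB; rewrite -mulrBl normrM normfV (gtr0_norm S_gt0) ler_pM2r ?invr_gt0.
rewrite -/S -AB1 ler_norml => /andP[? ?].
by case/orP: lt_eta => ?; lra.
Qed.

(** Parts are counted with multiplicity, so that replacing one entry of the list by its
    two halves visibly preserves the property. *)
Definition list_partition (P : seq {set 'I_n}) : Prop :=
  (forall i, (\sum_(J <- P) (i \in J) = 1)%N) /\
  (forall J, J \in P -> eta <= weight J).

Lemma list_partition_nonempty P J : list_partition P -> J \in P -> (0 < #|J|)%N.
Proof.
move=> [_ wP] /wP; rewrite lt0n; apply: contraTneq => /eqP; rewrite cards_eq0.
by move=> /eqP ->; rewrite /weight big_set0 -ltNge.
Qed.

Lemma sum_list_partition (V : nmodType) (f : 'I_n -> V) P : list_partition P ->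
  \sum_(J <- P) \sum_(i in J) f i = \sum_i f i.
Proof.
move=> [cover1P _].
under eq_bigr do rewrite big_mkcond.
rewrite exchange_big; apply: eq_bigr => i _ /=.
rewrite -[RHS]mulr1n -(cover1P i) -sumrMnr.
by apply: eq_bigr => J _; case: (i \in J).
Qed.

(** Each part weighs at least [eta], and the total weight is 1. *)
Lemma size_list_partition P : list_partition P -> (size P)%:R <= eta^-1.
Proof.
move=> lP; rewrite -[eta^-1]mul1r ler_pdivlMr // -[leRHS]x_sum -(sum_list_partition x lP).
rewrite mulr_natl -sum1_size -sumrMnr big_seq [leRHS]big_seq.
by apply: ler_sum => J /lP.2.
Qed.

Lemma list_partition_disjoint P J J' i : list_partition P ->
  J \in P -> J' \in P -> i \in J -> i \in J' -> J = J'.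
Proof.
move=> [/(_ i) + _] JP J'P iJ iJ'; rewrite (perm_big _ (perm_to_rem JP)) big_cons iJ.
case: (eqVneq J J') => // neqJ /eqP; rewrite eqSS sum_nat_seq_eq0 => /allP/(_ J').
rewrite iJ' /= => noJ'; suff /noJ' : J' \in rem J P by []; apply: contraTT J'P => /= J'rem.
by rewrite (perm_mem (perm_to_rem JP)) inE negb_or J'rem eq_sym neqJ.
Qed.

Lemma list_partition_cover P i : list_partition P -> exists2 J, J \in P & i \in J.
Proof.
move=> [/(_ i) cnt _]; apply/hasP; apply: contra_eqT cnt => /hasPn noJ.
by rewrite big_seq big1 // => J /noJ /negbTE ->.
Qed.

Lemma split_first_cons (J : {set 'I_n}) (P : seq {set 'I_n}) :
  split_first x eta (J :: P) =
    (if (split_part x eta J).1 is Some AB then Some [:: AB.1, AB.2 & P]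
     else omap (cons J) (split_first x eta P).1,
     ((split_part x eta J).2 +
      (if (split_part x eta J).1 is Some _ then 0 else (split_first x eta P).2))%N).
Proof.
rewrite [LHS]/(bind (split_part x eta J) _) /bind.
by case: (split_part x eta J) => [[AB|] c] /=; rewrite ?addn0.
Qed.

Lemma split_firstP (P : seq {set 'I_n}) : (forall J, J \in P -> (0 < #|J|)%N) ->
  ((split_first x eta P).2 <= \sum_(J <- P) (4 * #|J| + 3))%N /\
  match (split_first x eta P).1 with
  | None => forall J, J \in P -> dominated J
  | Some P' => exists P1 P2 J A B,
      [/\ P = P1 ++ J :: P2, P' = P1 ++ [:: A, B & P2],
          forall i, ((i \in A) + (i \in B) = (i \in J))%N,
          eta <= weight A & eta <= weight B]
  end.
Proof.
elim: P => [|J P IHP] Pne; first by rewrite big_nil.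
have [costJ] := split_partP (Pne J (mem_head _ _)).
have [|costP] := IHP; first by move=> I IP; apply: Pne; rewrite inE IP orbT.
rewrite big_cons split_first_cons.
case: (split_part x eta J) costJ => [[[A B]|] c] /=.
  move=> -> _ [cnt wA wB]; split; first by lia.
  by exists [::], P, J, A, B.
move=> ->; case: (split_first x eta P) costP => [[P'|] c'] /= costP.
  move=> splitP _; split; first by rewrite leq_add2l.
  have [P1 [P2 [I [A [B [-> -> cnt wA wB]]]]]] := splitP.
  by exists (J :: P1), P2, I, A, B.
move=> domP domJ; split; first by rewrite leq_add2l.
by move=> I; rewrite inE => /predU1P[->|/domP].
Qed.

(** The parts are nonempty and their sizes sum to [n], so that there are at most
    [n] of them. *)
Lemma split_first_cost P : list_partition P ->
  ((split_first x eta P).2 <= 7 * n)%N.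
Proof.
move=> lP; have Pne J := @list_partition_nonempty P J lP.
apply: leq_trans (split_firstP Pne).1 _.
have -> : (7 * n = \sum_(J <- P) 7 * #|J|)%N.
  rewrite -big_distrr /= -[in LHS](card_ord n) -sum1_card.
  rewrite -(sum_list_partition (fun=> 1%N) lP).
  by congr muln; apply: eq_bigr => J _; rewrite sum1_card.
rewrite big_seq [leqRHS]big_seq; apply: leq_sum => J /Pne; lia.
Qed.

(** Every split adds one part and the number of parts is at most [1 / eta], so
    there are boundedly many passes, each of linear cost. *)
Lemma greedy_loop_from (k : nat) P : list_partition P ->
  eta^-1 < (size P + k)%:R ->
  exists Q N, [/\ greedy_loop x eta P Q N, (N <= k * (7 * n))%N,
                  list_partition Q & forall J, J \in Q -> dominated J].
Proof.
elim: k P => [|k IHk] P lP lt_k.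
  by move: lt_k; rewrite addn0 ltNge size_list_partition.
have cost := split_first_cost lP.
have [_] := split_firstP (fun J => @list_partition_nonempty P J lP).
case E: (split_first x eta P) cost => [[P'|] N0] /= cost; last first.
  move=> domP; exists P, N0; split=> //; first exact: GreedyStop.
  by rewrite mulSn (leq_trans cost) ?leq_addr.
move=> [P1 [P2 [J [A [B [defP defP' cnt wA wB]]]]]].
have lP' : list_partition P'.
  case: lP => covP wP; split=> [i|I].
    move: (covP i); rewrite defP defP' !big_cat /= !big_cons => <-.
    by rewrite -cnt !addnA.
  rewrite defP' mem_cat !inE => /or4P[IP|/eqP->|/eqP->|IP] //;
    by apply: wP; rewrite defP mem_cat ?inE IP ?orbT.
have [|Q [N [loopQ costN lQ domQ]]] := IHk P' lP'.
  move: lt_k; rewrite defP defP' !size_cat /=.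
  by congr (_ < _%:R); lia.
exists Q, (N0 + N)%N; split=> //; first exact: GreedyStep E loopQ.
by rewrite mulSn leq_add.
Qed.

Lemma greedy_loop_exists : eta <= 1 ->
  exists Q N, [/\ greedy_loop x eta [:: setT] Q N,
    (N <= Num.bound eta^-1 * (7 * n))%N,
    list_partition Q & forall J, J \in Q -> dominated J].
Proof.
move=> eta_le1; apply: greedy_loop_from.
  split=> [i|J]; first by rewrite big_seq1 inE.
  by rewrite inE => /eqP ->; rewrite /weight big_set x_sum.
have /archi_boundP : 0 <= eta^-1 by rewrite invr_ge0 ltW.
by move=> /lt_le_trans; apply; rewrite ler_nat leq_addl.
Qed.

End GreedyLoopAnalysis.

(** * The greedy amalgamating algorithm on a graph *)

Section GreedyOutput.
Variables (R : realType) (T : finType) (H : sgraph T).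
Hypothesis m_gt0 : (0 < num_edges H)%N.

(** A vertex is sent to the part of positive volume that absorbs its own part.  The absorbed
    parts consist of isolated vertices, so the volumes do not change.  Presenting the
    blocks as the fibers of a map makes disjointness and covering automatic. *)
Lemma greedy_inputP (A : {set {set T}}) (B : seq {set T}) :
  partition A setT -> greedy_input H A B ->
  exists idx : T -> 'I_(size B),
    [/\ forall i : 'I_(size B), nth set0 B i = [set v | idx v == i],
        forall i : 'I_(size B), (0 < vol H (nth set0 B i))%N,
        forall i : 'I_(size B), exists2 X, X \in A &
          X \subset nth set0 B i /\ vol H X = vol H (nth set0 B i) &
        forall Z, Z \in A -> exists i : 'I_(size B), Z \subset nth set0 B i].
Proof.
move=> AT; have /and3P[/eqP covA tA A0] := AT.
case=> [B' m0|s f _ perm_s _ f_s]; first by have := m_gt0; rewrite m0.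
set blk := fun X : {set T} => X :|: _.
have sP X : (X \in s) = (X \in A) && (0 < vol H X)%N.
  by rewrite (perm_mem perm_s) mem_enum inE.
have us : uniq s by rewrite (perm_uniq perm_s) enum_uniq.
(* The part of positive volume into which Z goes. *)
pose home Z := if vol H Z == 0%N then f Z else Z.
have home_s Z : Z \in A -> home Z \in s.
  by rewrite /home; case: posnP => [v0 /f_s->|vZ ZA] //; rewrite sP ZA.
have pbA v : pblock A v \in A by rewrite pblock_mem // covA inE.
have mem_pb v : v \in pblock A v by rewrite mem_pblock covA inE.
have mem_blk X v : X \in s -> (v \in blk X) = (home (pblock A v) == X).
  rewrite sP => /andP[XA vX]; apply/idP/idP.
    rewrite inE => /orP[vX'|/bigcupP[Z /and3P[ZA /eqP vZ0 /eqP fZ] vZ]].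
      by rewrite (def_pblock tA XA vX') /home gtn_eqF.
    by rewrite (def_pblock tA ZA vZ) /home vZ0 fZ.
  rewrite /home inE; case: posnP => [vZ0 /eqP fX|_ /eqP <-]; last by rewrite mem_pb.
  apply/orP; right; apply/bigcupP; exists (pblock A v) => //.
  by rewrite pbA vZ0 fX !eqxx.
have idx_lt v : (index (home (pblock A v)) s < size (map blk s))%N.
  by rewrite size_map index_mem home_s.
pose idx v := Ordinal (idx_lt v).
have lt_s (i : 'I_(size (map blk s))) : (i < size s)%N.
  by apply: leq_trans (ltn_ord i) _; rewrite size_map.
have nthE (i : 'I_(size (map blk s))) : nth set0 (map blk s) i = [set v | idx v == i].
  apply/setP => v; rewrite (nth_map set0) // mem_blk ?mem_nth // inE.
  apply/eqP/eqP => [hv|<-]; last by rewrite nth_index ?home_s.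
  by apply: val_inj; rewrite /= hv index_uniq.
have vol_blk X : X \in s -> vol H (blk X) = vol H X.
  move=> Xs; rewrite {1}/vol (big_setID X) /= [blk X :&: X]setUK.
  rewrite [X in (_ + X)%N]big1 ?addn0 // => v; rewrite !inE => /andP[vX /orP[|]].
    by rewrite (negbTE vX).
  case/bigcupP=> Z /and3P[_ /eqP + _] vZ; rewrite /vol (bigD1 v) //=.
  by case: (deg H v).
exists idx; split=> [//|i|i|Z ZA].
- rewrite (nth_map set0) // vol_blk ?mem_nth //.
  by have := mem_nth set0 (lt_s i); rewrite sP => /andP[].
- exists (nth set0 s i); first by have := mem_nth set0 (lt_s i); rewrite sP => /andP[].
  by rewrite (nth_map set0) // vol_blk ?mem_nth // subsetUl.
- have /set0Pn[v vZ] : Z != set0 by apply: contraNneq A0 => <-.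
  exists (idx v); rewrite nthE; apply/subsetP => w wZ; rewrite inE; apply/eqP/val_inj.
  by rewrite /= (def_pblock tA ZA vZ) (def_pblock tA ZA wZ).
Qed.

(** The output has at most [1 / eta] parts, of which each is dominated by one input part;
    hence merging costs at most [4 * eta]. *)
Lemma greedy_amalgamatingP (eta : R) (A : {set {set T}}) (B : seq {set T}) :
  0 < eta <= 1 -> partition A setT -> greedy_input H A B ->
  exists (A' : {set {set T}}) (N : nat),
    [/\ greedy_amalgamating H eta B A' N,
        (N <= 7 * Num.bound eta^-1 * size B)%N,
        partition A' setT, #|A'|%:R <= eta^-1 &
        modularity_score R H A - 4 * eta <= modularity_score R H A'].
Proof.
move=> /andP[eta_gt0 eta_le1] AT inB.
have [idx [nthE vol_gt0 dom refine]] := greedy_inputP AT inB.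
pose x (i : 'I_(size B)) : R := (vol H (nth set0 B i))%:R / (total_vol H)%:R.
have V_gt0 : 0 < (total_vol H)%:R :> R by rewrite ltr0n muln_gt0.
have bigcupE (J : {set 'I_(size B)}) :
    \bigcup_(i in J) nth set0 B i = [set v | idx v \in J].
  apply/setP => v; rewrite inE; apply/bigcupP/idP => [[i iJ]|vJ].
    by rewrite nthE inE => /eqP ->.
  by exists (idx v); rewrite // nthE inE.
have volJ (J : {set 'I_(size B)}) :
    weight x J = (vol H [set v | idx v \in J])%:R / (total_vol H)%:R.
  rewrite /weight -mulr_suml -natr_sum; congr (_%:R / _).
  rewrite {2}/vol (partition_big idx (mem J)) => [|v]; last by rewrite inE.
  apply: eq_bigr => i iJ; rewrite /vol; apply: eq_bigl => v.
  by rewrite nthE !inE; case: eqP => [->|]; rewrite ?andbF ?iJ.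
have x_gt0 i : 0 < x i by rewrite divr_gt0 // ltr0n.
have x_sum : \sum_i x i = 1.
  have <- : weight x setT = \sum_i x i by apply: eq_bigl => i; rewrite inE.
  rewrite volJ; have -> : [set v | idx v \in setT] = setT by apply/setP => v; rewrite !inE.
  by rewrite volT divff ?gt_eqF.
have [P [N [loopP costN lP domP]]] := greedy_loop_exists x_gt0 x_sum eta_gt0 eta_le1.
set A' := [set \bigcup_(i in J) nth set0 B i | J : {set 'I_(size B)} in P].
have A'T : partition A' setT.
  apply/and3P; split.
  - apply/eqP/setP => v; rewrite inE; apply/bigcupP.
    have [J JP vJ] := list_partition_cover (idx v) lP.
    by exists (\bigcup_(i in J) nth set0 B i); [apply/imsetP; exists J | rewrite bigcupE inE].
  - apply/trivIsetP => _ _ /imsetP[J JP ->] /imsetP[J' J'P ->]; apply: contraNT.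
    rewrite -setI_eq0 => /set0Pn[v]; rewrite !bigcupE !inE => /andP[vJ vJ'].
    by rewrite (list_partition_disjoint lP JP J'P vJ vJ').
  - apply/imsetP => -[J JP]; rewrite bigcupE => J0.
    have /card_gt0P[i iJ] := list_partition_nonempty eta_gt0 lP JP.
    have := vol_gt0 i; rewrite (_ : nth set0 B i = set0) ?/vol ?big_set0 //.
    apply/setP => v; rewrite nthE !inE; apply/negbTE/eqP => vi.
    by have := in_set0 v; rewrite J0 inE vi iJ.
exists A', N; split=> //.
- exact: GreedyAmalgamated.
- by apply: leq_trans costN _; rewrite mulnA [(_ * 7)%N]mulnC.
- apply: le_trans (size_list_partition x_sum eta_gt0 lP); rewrite ler_nat.
  exact: leq_trans (leq_imset_card _ _) (card_size P).
have -> : 4 * eta = 2 * (2 * eta) by ring.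
apply: modularity_score_coarsen => // [|Z /refine[i Zi]|_ /imsetP[J JP ->]].
- by rewrite mulr_ge0 ?ltW.
- have [J JP iJ] := list_partition_cover i lP.
  exists (\bigcup_(i in J) nth set0 B i); first by apply/imsetP; exists J.
  exact: subset_trans Zi (bigcup_sup i iJ).
have [i iJ wJ] := domP J JP; have [X XA [Xi volX]] := dom i.
exists X; split=> //; first exact: subset_trans Xi (bigcup_sup i iJ).
move: wJ; rewrite volJ -bigcupE ler_pdivrMr // mulrDl divfK ?gt_eqF //.
by rewrite volX.
Qed.

Lemma greedy_input_exists (A : {set {set T}}) :
  partition A setT -> exists B, greedy_input H A B.
Proof.
move=> AT; pose P := [set X in A | (0 < vol H X)%N].
pose leV (X Y : {set T}) := (vol H Y <= vol H X)%N.
have [X XP] : exists X, X \in P.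
  apply/set0Pn; apply: contraTneq m_gt0 => P0; rewrite -leqNgt leqn0.
  have : (2 * num_edges H)%N == 0%N; last by rewrite muln_eq0.
  rewrite -[(2 * _)%N]volT -(vol_partition H AT) sum_nat_eq0.
  apply/forall_inP => X XA; have := in_set0 X; rewrite -P0 inE XA.
  by case: (vol H X).
eexists; apply: (@MergedInput _ _ _ (sort leV (enum P)) (fun=> X)) => //.
- by rewrite perm_sort.
- by apply: sort_sorted => Y Z; exact: leq_total.
- by move=> Z _ _; rewrite mem_sort mem_enum.
Qed.

End GreedyOutput.

(** * Concentration of the edge counts of the random subgraph *)

Section Concentration.
Variables (R : realType) (T : finType) (G : sgraph T) (p : R).
Hypothesis p01 : 0 < p <= 1.

Lemma random_subgraph_pmf_ge0 (H : sgraph T) : 0 <= random_subgraph_pmf G p H.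
Proof.
rewrite /random_subgraph_pmf; case: ifP => // _.
by have /andP[? ?] := p01; apply: prodr_ge0 => e _; case: ifP => _; lra.
Qed.

(** Independence of the edges: expanding the product over [E(G)] of the sums of the two
    weights of each edge gives one term for each subgraph. *)
Lemma sum_random_subgraph_prod (f g : {set T} -> R) :
  \sum_(H : sgraph T) random_subgraph_pmf G p H *
      \prod_(e in edges G) (if e \in edges H then f e else g e) =
  \prod_(e in edges G) (p * f e + (1 - p) * g e).
Proof.
pose F e := if e \in edges G then p * f e else 0.
pose F' e := if e \in edges G then (1 - p) * g e else 1.
have prodE (J : {set {set T}}) :
    \prod_e (if e \in J then F e else F' e) =
    if J \subset edges G then
      \prod_(e in edges G) (if e \in J then p else 1 - p) *
      \prod_(e in edges G) (if e \in J then f e else g e)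
    else 0.
  case: ifP => [JG|/negbT/subsetPn[e eJ eG]]; last first.
    by rewrite (bigD1 e) //= eJ /F (negbTE eG) mul0r.
  rewrite -big_split [RHS]big_mkcond; apply: eq_bigr => e _; rewrite /F /F' /=.
  have := subsetP JG e; case: (e \in J) => [->//|_].
  by case: (e \in edges G).
transitivity (\prod_e (F e + F' e)); last first.
  rewrite [RHS]big_mkcond; apply: eq_bigr => e _; rewrite /F /F'.
  by case: ifP => // _; rewrite add0r.
rewrite bigA_distr (bigID (fun J : {set {set T}} => J \subset edges G)) /=.
rewrite [X in _ = _ + X]big1 ?addr0; last by move=> J /negbTE JG; rewrite prodE JG.
rewrite (bigID (fun H : sgraph T => edges H \subset edges G)) /=.
rewrite [X in _ + X = _]big1 ?addr0; last first.
  by move=> H /negbTE HG; rewrite /random_subgraph_pmf HG mul0r.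
pose mk J : sgraph T := insubd G J.
have mkK (J : {set {set T}}) : J \subset edges G -> edges (mk J) = J.
  move=> JG; rewrite /mk insubdK //; apply/forall_inP => e /(subsetP JG) eG.
  by rewrite (edge_card2 eG).
rewrite [RHS](reindex_onto (@edges T) mk) => [|J]; last exact: mkK.
apply: eq_big => [H|H HG].
  case HG: (edges H \subset edges G) => //=; apply/esym/eqP.
  by apply: (@val_inj _ _ (sgraph T)); exact: mkK.
by rewrite prodE HG /random_subgraph_pmf HG.
Qed.

Lemma sum_random_subgraph_pmf : \sum_(H : sgraph T) random_subgraph_pmf G p H = 1.
Proof.
transitivity (\prod_(e in edges G) (p * 1 + (1 - p) * 1)).
  rewrite -(sum_random_subgraph_prod (fun=> 1) (fun=> 1)); apply: eq_bigr => H _.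
  by rewrite big1 ?mulr1 // => e _; exact: if_same.
by rewrite big1 // => e _; ring.
Qed.

(** The moment generating function of the binomial variable [edges_in H S]. *)
Lemma mgf_edges_in (S : {set T}) (a : R) :
  \sum_(H : sgraph T) random_subgraph_pmf G p H * a ^+ edges_in H S =
  (1 + p * (a - 1)) ^+ edges_in G S.
Proof.
have := sum_random_subgraph_prod (fun e => if e \subset S then a else 1) (fun=> 1).
have -> : \prod_(e in edges G) (p * (if e \subset S then a else 1) + (1 - p) * 1) =
          (1 + p * (a - 1)) ^+ edges_in G S.
  rewrite /edges_in -prodr_const [LHS](bigID (fun e : {set T} => e \subset S)) /=.
  rewrite [X in _ * X]big1 ?mulr1; last by move=> e /andP[_ /negbTE ->]; ring.
  apply: eq_big => [e|e /andP[_ ->]]; first by rewrite inE.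
  by ring.
move=> <-; apply: eq_bigr => H _.
rewrite {1}/random_subgraph_pmf [in RHS]/random_subgraph_pmf.
case: ifP => [HG|_]; last by rewrite !mul0r.
congr (_ * _); rewrite /edges_in -prodr_const big_mkcond [RHS]big_mkcond.
apply: eq_bigr => e _; rewrite inE; have := subsetP HG e.
case: (e \in edges H) => [->//|_] /=; by case: (e \in edges G).
Qed.

(** Since [exp (- t) >= 1 - t], it is enough that
    [(1 - t) * (1 + t + 2 * t ^ 2) = 1 + t ^ 2 * (1 - 2 * t) >= 1]. *)
Lemma expR_quadratic (t : R) : t <= 2^-1 -> expR t <= 1 + t + 2 * t ^+ 2.
Proof.
move=> t_le; have e_gt0 := expR_gt0 t.
have : (1 - t) * expR t <= 1 by rewrite -ler_pdivlMr // div1r -expRN expR_ge1Dx.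
move=> /le_trans le1; have t_lt1 : 0 < 1 - t by lra.
rewrite -(ler_pM2l t_lt1); apply: le1.
have : 0 <= t ^+ 2 * (1 - 2 * t) by rewrite mulr_ge0 ?sqr_ge0 //; lra.
lra.
Qed.

(** Chernoff's bound, for both tails at once: [u] is [d / 4] for the upper tail and
    [- d / 4] for the lower tail. *)
Lemma chernoff_edges_in (S : {set T}) (d u : R) : 0 < d <= 1 -> `|u| = d / 4 ->
  \sum_(H : sgraph T | d / 4 * (d * (p * (num_edges G)%:R)) <
        u * ((edges_in H S)%:R - p * (edges_in G S)%:R)) random_subgraph_pmf G p H
  <= expR (- (d ^+ 2 / 8 * (p * (num_edges G)%:R))).
Proof.
move=> /andP[d_gt0 d_le1] u_abs.
(* Markov's inequality for exp (u * e(S)); c collects the deterministic part of the exponent. *)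
set M := p * (num_edges G)%:R; set k := edges_in G S.
pose c := - (d / 4 * (d * M)) - u * (p * k%:R).
apply: (@le_trans _ _ (\sum_(H : sgraph T)
           random_subgraph_pmf G p H * expR u ^+ edges_in H S * expR c)).
  rewrite big_mkcond; apply: ler_sum => H _; have pmf_ge0 := random_subgraph_pmf_ge0 H.
  have exponent_ge0 : d / 4 * (d * M) < u * ((edges_in H S)%:R - p * k%:R) ->
      0 <= (edges_in H S)%:R * u + c by rewrite /c; lra.
  have w_ge0 : 0 <= expR u ^+ edges_in H S * expR c.
    by rewrite mulr_ge0 ?exprn_ge0 ?expR_ge0.
  rewrite -[leRHS]mulrA; case: ifP => [tail|_]; last exact: mulr_ge0.
  rewrite -{1}[random_subgraph_pmf G p H]mulr1 ler_wpM2l //.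
  rewrite -expRM_natl -expRD; apply: le_trans (expR_ge1Dx _).
  by rewrite lerDl exponent_ge0.
rewrite -mulr_suml mgf_edges_in -/k.
have u_le : u <= d / 4 by rewrite -u_abs ler_norm.
have u_sqr : u ^+ 2 = (d / 4) ^+ 2 by rewrite -u_abs real_normK ?num_real.
have exp_le : expR u - 1 <= u + 2 * (d / 4) ^+ 2.
  have := @expR_quadratic u; rewrite u_sqr; lra.
apply: (@le_trans _ _ (expR (p * (expR u - 1)) ^+ k * expR c)).
  rewrite ler_pM2r ?expR_gt0 // lerXn2r ?nnegrE ?expR_ge0 ?expR_ge1Dx //.
  have /andP[p_gt0 p_le1] := p01; have := mulr_gt0 p_gt0 (expR_gt0 u); lra.
rewrite -expRM_natl -expRD ler_expR.
have k_le : p * k%:R <= M by rewrite ler_pM2l ?ler_nat ?edges_in_le //; case/andP: p01.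
have k_ge0 : 0 <= p * k%:R by rewrite mulr_ge0 // ltW //; case/andP: p01.
apply: (@le_trans _ _ (p * k%:R * (2 * (d / 4) ^+ 2) - d / 4 * (d * M))).
  by have := ler_wpM2l k_ge0 exp_le; rewrite /c; lra.
by have := ler_wpM2r (sqr_ge0 d) k_le; lra.
Qed.

(** Only [2 ^ n] vertex sets need to be controlled, against failure probabilities
    exponentially small in [p * e(G)], which is at least a large multiple of [n]. *)
Lemma edge_counts_close_prob (d e : R) : 0 < d <= 1 -> 0 < e <= 1 -> (0 < #|T|)%N ->
  32 / (d ^+ 2 * e) * #|T|%:R <= p * (num_edges G)%:R ->
  1 - e <= random_subgraph_prob G p (fun H => edge_counts_close G H p d).
Proof.
move=> d01 e01 T_gt0 dense; have /andP[d_gt0 d_le1] := d01; have /andP[e_gt0 e_le1] := e01.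
set M := p * (num_edges G)%:R in dense *.
pose bad u (S : {set T}) (H : sgraph T) :=
  d / 4 * (d * M) < u * ((edges_in H S)%:R - p * (edges_in G S)%:R).
rewrite /random_subgraph_prob lerBlDr -sum_random_subgraph_pmf.
rewrite (bigID (fun H : sgraph T => `[< edge_counts_close G H p d >])) /= lerD2l.
(* The exponent is at least (4 / e) * n, and exp (- 4 / e) <= e / 4. *)
have tail_le S u : `|u| = d / 4 ->
    \sum_(H : sgraph T | bad u S H) random_subgraph_pmf G p H <= (e / 4) ^+ #|T|.
  move=> u_abs; apply: le_trans (chernoff_edges_in S d01 u_abs) _; rewrite -/M.
  apply: (@le_trans _ _ (expR (- (4 / e)) ^+ #|T|)).
    rewrite -expRM_natl ler_expR mulrN lerN2.
    have -> : #|T|%:R * (4 / e) = d ^+ 2 / 8 * (32 / (d ^+ 2 * e) * #|T|%:R).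
      by field; rewrite !gt_eqF.
    by rewrite ler_pM2l // divr_gt0 ?exprn_gt0.
  rewrite lerXn2r ?nnegrE ?expR_ge0 ?divr_ge0 ?(ltW e_gt0) //.
  rewrite expRN -[leRHS]invrK lef_pV2 ?posrE ?expR_gt0 ?invr_gt0 ?divr_gt0 //.
  rewrite invf_div; apply: le_trans (expR_ge1Dx _); lra.
apply: (@le_trans _ _ (\sum_(S : {set T}) \sum_(H : sgraph T)
    ((if bad (d / 4) S H then random_subgraph_pmf G p H else 0) +
     (if bad (- (d / 4)) S H then random_subgraph_pmf G p H else 0)))).
  rewrite exchange_big big_mkcond; apply: ler_sum => H _.
  have pmf_ge0 := random_subgraph_pmf_ge0 H.
  have term_ge0 S : 0 <= (if bad (d / 4) S H then random_subgraph_pmf G p H else 0) +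
     (if bad (- (d / 4)) S H then random_subgraph_pmf G p H else 0).
    by apply: addr_ge0; case: ifP.
  case: ifP => [/asboolPn/existsNP[S /negP]|_]; last by apply: sumr_ge0 => S _.
  rewrite -ltNge => far; rewrite (bigD1 S) //=.
  apply: ler_wpDr; first by apply: sumr_ge0 => S' _.
  suff : bad (d / 4) S H || bad (- (d / 4)) S H.
    by case/orP=> ->; [apply: ler_wpDr | apply: ler_wpDl] => //; case: ifP.
  move: far; rewrite /bad -/M mulNr -mulrN !ltr_pM2l ?divr_gt0 //.
  by rewrite lter_normr.
apply: (@le_trans _ _ (\sum_(S : {set T}) ((e / 4) ^+ #|T| + (e / 4) ^+ #|T|))).
  apply: ler_sum => S _; rewrite big_split -!big_mkcond /=.
  have abs_d : `|d / 4| = d / 4 by rewrite ger0_norm // divr_ge0 // ltW.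
  by apply: lerD; apply: tail_le; rewrite ?normrN.
(* The sum is 2 * (2 * (e / 4)) ^ n, which is at most 2 * (e / 2) = e. *)
have card_sets : #|{: {set T}}| = (2 ^ #|T|)%N.
  by have := card_powerset [set: T]; rewrite powersetT !cardsT.
rewrite sumr_const card_sets -mulr2n -mulrnA -[leLHS]mulr_natl natrM natrX.
rewrite -mulrA -exprMn (_ : 2 * (e / 4) = e / 2); last by field.
rewrite [leRHS](_ : e = 2 * (e / 2)); last by field.
rewrite ler_pM2l // -[leRHS]expr1 ler_wiXn2l //; lra.
Qed.

End Concentration.

(** * Modularity under edge sampling *)

(** Two graphs with close scores on partitions into few parts have close modularities:
    greedy amalgamation turns any partition into one with few parts, at a cost of at most
    [4 * eta]. *)
Lemma modularity_transfer (R : realType) (T : finType) (G H : sgraph T) (eta r : R) :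
  (0 < num_edges G)%N -> (0 < #|T|)%N -> 0 < eta <= 1 ->
  (forall P : {set {set T}}, #|P|%:R <= eta^-1 ->
     modularity_score R G P <= modularity_score R H P + r) ->
  modularity R G <= modularity R H + (4 * eta + r).
Proof.
move=> m_gt0 T_gt0 eta01 close; apply: modularity_le => // P PT.
have [B inB] := greedy_input_exists m_gt0 PT.
have [Q [_ [_ _ QT Q_few PQ]]] := greedy_amalgamatingP m_gt0 eta01 PT inB.
have := close Q Q_few; have := le_modularity R H QT; lra.
Qed.

Lemma random_subgraph_prob_le (R : realType) (T : finType) (G : sgraph T) (p : R)
    (Q Q' : sgraph T -> Prop) : 0 < p <= 1 -> (forall H, Q H -> Q' H) ->
  random_subgraph_prob G p Q <= random_subgraph_prob G p Q'.
Proof.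
move=> p01 QQ'; rewrite /random_subgraph_prob big_mkcond [leRHS]big_mkcond.
apply: ler_sum => H _; have := random_subgraph_pmf_ge0 G p01 H.
by case: asboolP => [/QQ' QH|_]; case: asboolP.
Qed.

Theorem theorem1p2 (R : realType) (eps : R) (eps_gt0 : 0 < eps) :
  exists (c eta : R) (K : nat), (0 < eta <= 1) /\
  forall (T : finType) (G : sgraph T) (p : R),
    0 < p <= 1 ->
    c <= (num_edges G)%:R * p / (num_vertices T)%:R ->
    1 - eps <= random_subgraph_prob G p (fun Gp : sgraph T =>
      (`|modularity R Gp - modularity R G| < eps) /\
      (forall (A : {set {set T}}) (B : seq {set T}),
         partition A [set: T] -> greedy_input Gp A B ->
         exists (A' : {set {set T}}) (N : nat),
           [/\ greedy_amalgamating Gp eta B A' N,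
               (N <= K * size B)%N,
               partition A' [set: T] &
               modularity_score R Gp A - eps <= modularity_score R G A'])).
Proof.
pose e := Num.min 1 eps.
have /andP[e_gt0 e_le1] : 0 < e <= 1 by rewrite lt_min ge_min ltr01 eps_gt0 lexx.
have e_eps : e <= eps by rewrite ge_min lexx orbT.
(* Amalgamation costs 4 * eta = e / 4, and the scores of partitions into at most
   1 / eta parts move by at most (1 / eta) * (7 * d) = e / 4. *)
pose eta := e / 16; pose d := eta * (e / 28).
have eta_gt0 : 0 < eta by rewrite /eta; lra.
have d_gt0 : 0 < d by rewrite mulr_gt0 ?divr_gt0.
have d_lt1 : d < 1 by rewrite /d /eta; nra.
have eta01 : 0 < eta <= 1 by rewrite eta_gt0 /eta; lra.
exists (32 / (d ^+ 2 * e)), eta, (7 * Num.bound eta^-1)%N; split=> // T G p p01.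
set c := 32 / _ => dense; have /andP[p_gt0 _] := p01.
have c_gt0 : 0 < c by rewrite divr_gt0 // mulr_gt0 // exprn_gt0.
have T_gt0 : (0 < #|T|)%N.
  rewrite lt0n; apply: contraTneq dense => T0.
  by rewrite /num_vertices T0 invr0 mulr0 -ltNge.
have {}dense : c * #|T|%:R <= p * (num_edges G)%:R.
  by move: dense; rewrite ler_pdivlMr ?ltr0n // [_ * p]mulrC.
have m_gt0 : (0 < num_edges G)%N.
  rewrite lt0n; apply: contraTneq dense => ->.
  by rewrite mulr0 -ltNge mulr_gt0 ?ltr0n.
have d01 : 0 < d <= 1 by rewrite d_gt0 ltW.
have e01 : 0 < e <= 1 by rewrite e_gt0.
apply: le_trans (_ : 1 - e <= _); first by lra.
apply: le_trans (edge_counts_close_prob p01 d01 e01 T_gt0 dense) _.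
apply: random_subgraph_prob_le => // H close.
have mH_gt0 := edge_counts_close_gt0 m_gt0 p_gt0 d_lt1 close.
have scores_close (P : {set {set T}}) : #|P|%:R <= eta^-1 ->
    `|modularity_score R H P - modularity_score R G P| <= e / 4.
  move=> P_few; have d_lt : 0 < d < 1 by rewrite d_gt0.
  apply: le_trans (modularity_score_close P m_gt0 p_gt0 d_lt close) _.
  apply: le_trans (_ : eta^-1 * (7 * d) <= _).
    by rewrite ler_pM2r // mulr_gt0.
  have -> : eta^-1 * (7 * d) = e / 4 by rewrite /d; field; rewrite gt_eqF.
  by [].
split=> [|A B AT inB].
  have GH : modularity R G <= modularity R H + (4 * eta + e / 4).
    apply: modularity_transfer => // P /scores_close.
    by rewrite ler_norml => /andP[? ?]; lra.
  have HG : modularity R H <= modularity R G + (4 * eta + e / 4).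
    apply: modularity_transfer => // P /scores_close.
    by rewrite ler_norml => /andP[? ?]; lra.
  by move: GH HG; rewrite ltr_norml /eta => ? ?; apply/andP; split; lra.
have [A' [N [algo costN A'T A'_few AA']]] := greedy_amalgamatingP mH_gt0 eta01 AT inB.
exists A', N; split=> //.
by move: (scores_close _ A'_few) AA'; rewrite ler_norml /eta => /andP[? ?] ?; lra.
Qed.
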